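(* For $n,k\ge0$ let $i_{n,k}$ be the number of intervals $[P,Q]$ in $\mathbb{F}_n^\infty$ such that the length of the first ascent of $Q$ minus the length of the first ascent of $P$ equals $k$. Then $$\sum_{n,k\ge0}i_{n,k}x^ny^k=1+\frac{2x}{1-2x-2xy+\sqrt{1-4x}}.$$ In particular the generating function of the number of intervals of $\mathbb{F}_n^\infty$ is $\frac12\left(1+\frac{1}{\sqrt{1-4x}}\right)$, and for $n\ge1$ the number of intervals of $\mathbb{F}_n^\infty$ is $\binom{2n-1}{n}$.
   Context: A Dyck path of semilength $n\ge 0$ is a lattice path from $(0,0)$ to $(2n,0)$ with steps $U=(1,1)$ and $D=(1,-1)$ that never goes below the $x$-axis; it is identified with its word over $\{U,D\}$. A path avoids a pattern $\alpha$ if $\alpha$ does not occur as a factor (block of consecutive steps). $\mathcal{F}_n^\infty$ is the set of Dyck paths of semilength $n$ avoiding $DUU$, ordered by the Stanley order: $P\le Q$ iff $P$ lies weakly below $Q$ when both are drawn in the plane; $\mathbb{F}_n^\infty=(\mathcal{F}_n^\infty,\le)$. An interval is $[P,Q]=\{R:P\le R\le Q\}$ with $P\le Q$ (including $P=Q$). The first ascent of a nonempty Dyck path is its maximal initial run of $U$ steps; for the empty path take its length to be $0$. *)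

(* Defs.v *)
From HB Require Import structures.
From mathcomp Require Import all_boot all_order all_algebra.
From mathcomp Require Import boolp.
Set Implicit Arguments.
Unset Strict Implicit.
Unset Printing Implicit Defensive.
Import Order.TTheory GRing.Theory Num.Theory.
Local Open Scope ring_scope.

(* Formal power series.  [fps R] is R[[x]], a series being given by its       *)
(* coefficient sequence; [fps (fps R)] is R[[y]][[x]] = R[[x, y]].            *)

Record fps (R : Type) : Type := Fps { coefs :> nat -> R }.

Lemma fpsP (R : Type) (f g : fps R) : f =1 g -> f = g.
Proof. by case: f g => f [g] /= /funext ->. Qed.

HB.instance Definition _ (R : Type) := gen_eqMixin (fps R).
HB.instance Definition _ (R : Type) := gen_choiceMixin (fps R).

Section FpsZmodule.
Context (R : zmodType).
Implicit Types f g h : fps R.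

Definition fps_zero : fps R := Fps (fun=> 0).
Definition fps_opp f : fps R := Fps (fun n => - f n).
Definition fps_add f g : fps R := Fps (fun n => f n + g n).

Fact fps_addA : associative fps_add.
Proof. by move=> f g h; apply: fpsP => n; exact: addrA. Qed.
Fact fps_addC : commutative fps_add.
Proof. by move=> f g; apply: fpsP => n; exact: addrC. Qed.
Fact fps_add0 : left_id fps_zero fps_add.
Proof. by move=> f; apply: fpsP => n; exact: add0r. Qed.
Fact fps_addN : left_inverse fps_zero fps_opp fps_add.
Proof. by move=> f; apply: fpsP => n; exact: addNr. Qed.

HB.instance Definition _ :=
  GRing.isZmodule.Build (fps R) fps_addA fps_addC fps_add0 fps_addN.

End FpsZmodule.

Section FpsRing.
Context (R : comNzRingType).
Implicit Types f g h : fps R.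

Definition fpsC (c : R) : fps R := Fps (fun n => if n == 0%N then c else 0).
Definition fpsX : fps R := Fps (fun n => (n == 1%N)%:R).
Definition fps_mul f g : fps R :=
  Fps (fun n => \sum_(i < n.+1) f i * g (n - i)%N).

Let trunc m f : {poly R} := \poly_(i < m) f i.

Let trunc_mul m f g n : (n < m)%N -> fps_mul f g n = (trunc m f * trunc m g)`_n.
Proof.
move=> ltnm; rewrite coefM; apply: eq_bigr => i _; rewrite !coef_poly.
by rewrite (leq_trans (ltn_ord i) ltnm) (leq_ltn_trans (leq_subr i n) ltnm).
Qed.

Fact fps_mulC : commutative fps_mul.
Proof. by move=> f g; apply: fpsP => n; rewrite !(trunc_mul _ _ (ltnSn n)) mulrC. Qed.

Fact fps_mulA : associative fps_mul.
Proof.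
move=> f g h; apply: fpsP => n.
have tM a b (i : nat) : (i <= n)%N ->
    (trunc n.+1 (fps_mul a b))`_i = (trunc n.+1 a * trunc n.+1 b)`_i.
  by move=> lein; rewrite coef_poly ltnS lein; apply: trunc_mul.
rewrite !(trunc_mul _ _ (ltnSn n)).
transitivity ((trunc n.+1 f * (trunc n.+1 g * trunc n.+1 h))`_n).
  by rewrite !coefM; apply: eq_bigr => i _; rewrite tM ?leq_subr.
rewrite mulrA !coefM; apply: eq_bigr => i _.
by rewrite tM // -ltnS.
Qed.

Fact fps_mul1 : left_id (fpsC 1) fps_mul.
Proof.
move=> f; apply: fpsP => n /=.
by rewrite big_ord_recl /= mul1r subn0 big1 ?addr0 // => i _; rewrite mul0r.
Qed.

Fact fps_mulDl : left_distributive fps_mul +%R.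
Proof.
move=> f g h; apply: fpsP => n /=.
by rewrite -big_split; apply: eq_bigr => i _; rewrite mulrDl.
Qed.

Fact fps_one_neq0 : fpsC 1 != 0.
Proof.
by apply/eqP => /(congr1 (fun f : fps R => f 0%N))/eqP; rewrite /= oner_eq0.
Qed.

HB.instance Definition _ := GRing.Zmodule_isComNzRing.Build (fps R)
  fps_mulA fps_mulC fps_mul1 fps_mulDl fps_one_neq0.

Lemma coef_fpsM f g n : (f * g) n = \sum_(i < n.+1) f i * g (n - i)%N.
Proof. by []. Qed.

End FpsRing.

Arguments fpsX {R}.

Section FpsRec.
Context (R : comUnitRingType).
Implicit Types f g : fps R.

(* Course-of-values recursion: the n-th coefficient of [fps_rec phi] is       *)
(* [phi s], with s the list of the n previous coefficients.                   *)
Fixpoint rec_prefix (phi : seq R -> R) n : seq R :=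
  if n is m.+1 then let s := rec_prefix phi m in rcons s (phi s) else [::].

Definition fps_rec (phi : seq R -> R) : fps R :=
  Fps (fun n => phi (rec_prefix phi n)).

Lemma size_rec_prefix phi n : size (rec_prefix phi n) = n.
Proof. by elim: n => //= n IHn; rewrite size_rcons IHn. Qed.

Lemma nth_rec_prefix phi n i :
  (i < n)%N -> (rec_prefix phi n)`_i = fps_rec phi i.
Proof.
elim: n => //= n IHn; rewrite ltnS nth_rcons size_rec_prefix leq_eqVlt.
by case/predU1P=> [->|ltin]; rewrite ?ltnn ?eqxx // ltin IHn.
Qed.

Definition fps_inv_step f (s : seq R) : R :=
  (f 0%N)^-1 * ((size s == 0%N)%:R - \sum_(i < size s) s`_i * f (size s - i)%N).

Definition fps_unit : {pred fps R} := fun f => f 0%N \is a GRing.unit.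

Definition fps_inv f : fps R :=
  if fps_unit f then fps_rec (fps_inv_step f) else f.

Fact fps_mulVf : {in fps_unit, left_inverse 1 fps_inv *%R}.
Proof.
move=> f Uf; have {}Uf : fps_unit f := Uf; apply: fpsP => n.
rewrite coef_fpsM /fps_inv Uf big_ord_recr subnn.
under eq_bigr => i _ do rewrite -(nth_rec_prefix _ (ltn_ord i)).
rewrite [fps_rec _ n]/= /fps_inv_step size_rec_prefix mulrAC mulVr // mul1r.
by rewrite [LHS]addrC subrK /=; case: eqP.
Qed.

Fact fps_unitPl f g : g * f = 1 -> fps_unit f.
Proof.
move=> /(congr1 (fun h : fps R => h 0%N)).
rewrite coef_fpsM big_ord1 /= => gf1.
by rewrite /fps_unit; apply/unitrPr; exists (g 0%N); rewrite mulrC.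
Qed.

Fact fps_inv_out : {in [predC fps_unit], fps_inv =1 id}.
Proof. by move=> f Nf; rewrite /fps_inv ifN. Qed.

HB.instance Definition _ := GRing.ComNzRing_hasMulInverse.Build (fps R)
  fps_mulVf fps_unitPl fps_inv_out.

Lemma fps_unitE f : (f \is a GRing.unit) = (f 0%N \is a GRing.unit).
Proof. by []. Qed.

(* The square root with constant coefficient 1 of a series f with constant    *)
(* coefficient 1 (see [fps_sqrtK] and [fps_sqrt_uniq]); irrelevant otherwise. *)
Definition fps_sqrt_step f (s : seq R) : R :=
  if s is [::] then 1 else
  (f (size s) - \sum_(1 <= i < size s) s`_i * s`_(size s - i)%N) / 2.

Definition fps_sqrt f : fps R := fps_rec (fps_sqrt_step f).

Lemma coef0_fps_sqrt f : fps_sqrt f 0%N = 1.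
Proof. by []. Qed.

Lemma coefS_fps_sqrt f n : fps_sqrt f n.+1 =
  (f n.+1 - \sum_(1 <= i < n.+1) fps_sqrt f i * fps_sqrt f (n.+1 - i)%N) / 2.
Proof.
have stepE t : (0 < size t)%N -> fps_sqrt_step f t =
  (f (size t) - \sum_(1 <= i < size t) t`_i * t`_(size t - i)%N) / 2 by case: t.
rewrite -[LHS]/(fps_sqrt_step f (rec_prefix _ n.+1)).
rewrite stepE size_rec_prefix //; congr ((f _ - _) / 2).
apply: eq_big_nat => i /andP[i0 ltin].
by rewrite !nth_rec_prefix // ltn_subrL i0.
Qed.

Lemma coefS_sqr f n : f 0%N = 1 -> (f ^+ 2) n.+1 =
  \sum_(1 <= i < n.+1) f i * f (n.+1 - i)%N + f n.+1 * 2.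
Proof.
move=> f0; rewrite expr2 coef_fpsM -(big_mkord xpredT (fun i => f i * f (_ - i)%N)).
rewrite big_nat_recl // subn0 f0 mul1r big_nat_recr //= subnn f0 mulr1.
by rewrite big_add1 /= addrCA mulr_natr.
Qed.

Lemma fps_sqrtK f :
  2 \is a @GRing.unit R -> f 0%N = 1 -> fps_sqrt f ^+ 2 = f.
Proof.
move=> U2 f0; apply: fpsP => -[|n].
  by rewrite expr2 coef_fpsM big_ord1 coef0_fps_sqrt mulr1.
by rewrite coefS_sqr // coefS_fps_sqrt divrK // addrC subrK.
Qed.

Lemma fps_sqrt_uniq f g :
  2 \is a @GRing.unit R -> g 0%N = 1 -> g ^+ 2 = f -> g = fps_sqrt f.
Proof.
move=> U2 g0 gf; apply: fpsP => n; elim/ltn_ind: n => -[|n] IHn //.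
have -> : fps_sqrt f n.+1 =
    (f n.+1 - \sum_(1 <= i < n.+1) g i * g (n.+1 - i)%N) / 2.
  rewrite coefS_fps_sqrt; congr ((_ - _) / 2).
  apply: eq_big_nat => i /andP[i0 ltin].
  by rewrite !IHn ?ltn_subrL ?i0.
rewrite -gf coefS_sqr //.
by rewrite addrAC subrr add0r mulrK.
Qed.

End FpsRec.

(* A word over {U, D} is a [seq bool], with U = true and D = false.           *)

Local Notation U := true.
Local Notation D := false.

Definition ordinate (s : seq bool) : int := \sum_(a <- s) (if a then 1 else -1).

(* The ordinate of the lattice path s at abscissa i (for i <= size s).        *)
Definition height (s : seq bool) (i : nat) : int := ordinate (take i s).

Definition is_dyck (s : seq bool) : bool :=
  (ordinate s == 0) && all (fun i => 0 <= height s i) (iota 0 (size s).+1).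

Definition avoids (alpha s : seq bool) : bool := ~~ infix alpha s.

Definition first_ascent (s : seq bool) : nat := find (pred1 D) s.

Record dyckDUU (n : nat) := DyckDUU {
  word :> n.*2.-tuple bool;
  _ : is_dyck word && avoids [:: D; U; U] word
}.

HB.instance Definition _ n := [isSub for @word n].
HB.instance Definition _ n := [Finite of dyckDUU n by <:].

Definition stanley_le n (P Q : dyckDUU n) : bool :=
  [forall i : 'I_(n.*2).+1, height P i <= height Q i].

Fact stanley_refl n : reflexive (@stanley_le n).
Proof. by move=> P; apply/forallP. Qed.

Lemma heightS (s : seq bool) i : (i < size s)%N ->
  height s i.+1 = height s i + (if nth D s i then 1 else -1).
Proof.
by move=> ltis; rewrite /height /ordinate (take_nth D) // -cats1 big_cat big_seq1.
Qed.

Fact stanley_anti n : antisymmetric (@stanley_le n).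
Proof.
move=> P Q /andP[/forallP PQ /forallP QP]; apply/val_inj/val_inj => /=.
have hE i : (i <= n.*2)%N -> height P i = height Q i.
  rewrite -ltnS => lti; apply/eqP; rewrite eq_le.
  by have := PQ (Ordinal lti); have := QP (Ordinal lti) => /= -> ->.
apply: (@eq_from_nth _ D) => [|i]; rewrite !size_tuple // => lti.
have := hE i.+1 lti; rewrite !heightS ?size_tuple // hE 1?ltnW // => /addrI.
by case: (nth _ _ _) (nth _ _ _) => [] [].
Qed.

Fact stanley_trans n : transitive (@stanley_le n).
Proof.
move=> Q P R /forallP PQ /forallP QR; apply/forallP => i.
exact: le_trans (PQ i) (QR i).
Qed.

Fact stanley_display : Order.disp_t. Proof. exact: Order.Disp tt tt. Qed.

HB.instance Definition _ n := Order.Le_isPOrder.Build stanley_display (dyckDUU n)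
  (@stanley_refl n) (@stanley_anti n) (@stanley_trans n).

Definition interval_set n (P Q : dyckDUU n) : {set dyckDUU n} :=
  [set R | (P <= R <= Q)%O].

Definition intervals n : {set {set dyckDUU n}} :=
  [set I | [exists P : dyckDUU n, exists Q : dyckDUU n,
     (P <= Q)%O && (I == interval_set P Q)]].

Definition intervals_ascent n (k : nat) : {set {set dyckDUU n}} :=
  [set I | [exists P : dyckDUU n, exists Q : dyckDUU n,
     [&& (P <= Q)%O, I == interval_set P Q &
         (first_ascent Q)%:Z - (first_ascent P)%:Z == k%:Z]]].

(* Main.v *)
(* A nonempty DUU-avoiding path of semilength n + 1 is U^a D followed by n     *)
(* blocks, each D or UD; it is encoded by the word w of length n over          *)
(* {D, UD} = {false, true}, with a - 1 the number of letters D. Comparing, for *)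
(* each d, how many up steps precede the d-th down step turns P <= Q into: each *)
(* suffix of w(P) has at least as many letters UD as the suffix of the same    *)
(* length of w(Q); and the first ascents differ by #UD(w(P)) - #UD(w(Q)). Read *)
(* from the right, such a pair of words is a bicolored Motzkin prefix of length *)
(* n, whose final height is that difference. The number of prefixes with final *)
(* height at least k is C(2n + 1, n + 1 + k), and their generating function is *)
(* obtained by checking that the claimed one satisfies the kernel equation,    *)
(* which determines all coefficients.                                          *)
From HB Require Import structures.
Require Import Defs.
From mathcomp Require Import all_boot all_order all_algebra.
From mathcomp Require Import zify ring.
Set Implicit Arguments.
Unset Strict Implicit.
Unset Printing Implicit Defensive.
Import Order.TTheory GRing.Theory Num.Theory.
Local Open Scope ring_scope.

(** Nonempty paths of semilength [n.+1] correspond bijectively to words of length [n]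
    ([dyck_avoidsE], [path_of_inj]). A path lies below another when its down steps come earlier
    ([height_leP]), which on words is [dominates] ([height_path_of_le]). Prepending a letter to both
    words changes the difference of their counts of [true] by 1, 0, 0 or -1, and dominance keeps it
    nonnegative; this gives [num_domS], solved by Pascal's rule in [num_dom_bin]. Intervals amount
    to ordered pairs ([interval_set_inj]). The closed form satisfies the kernel equation
    [motzkin2_prefix_kernel], whose coefficients obey the same recurrence
    ([coef_motzkin2_prefix]). *)

(** * Constants and coefficientwise morphisms of power series *)

Fact fpsC_is_zmod_morphism (R : comNzRingType) : zmod_morphism (@fpsC R).
Proof. by move=> a b; apply: fpsP => -[|n] //=; rewrite subrr. Qed.

Lemma coef_fpsCM (R : comNzRingType) (c : R) (f : fps R) n :
  (fpsC c * f) n = c * f n.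
Proof.
rewrite coef_fpsM big_ord_recl /= subn0 big1 ?addr0 // => i _.
by rewrite mul0r.
Qed.

Fact fpsC_is_monoid_morphism (R : comNzRingType) : monoid_morphism (@fpsC R).
Proof.
by split=> // a b; apply: fpsP => -[|n]; rewrite coef_fpsCM //= mulr0.
Qed.

HB.instance Definition _ (R : comNzRingType) :=
  GRing.isZmodMorphism.Build R (fps R) (@fpsC R) (@fpsC_is_zmod_morphism R).
HB.instance Definition _ (R : comNzRingType) :=
  GRing.isMonoidMorphism.Build R (fps R) (@fpsC R) (@fpsC_is_monoid_morphism R).

Lemma coef_fpsXM (R : comNzRingType) (f : fps R) n :
  (fpsX * f) n = if n is m.+1 then f m else 0.
Proof.
case: n => [|n]; first by rewrite coef_fpsM big_ord1 /= mul0r.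
rewrite coef_fpsM big_ord_recl mul0r add0r big_ord_recl /= mul1r subSS subn0.
by rewrite big1 ?addr0 // => i _; rewrite mul0r.
Qed.

Lemma coef_fps_nat (R : comNzRingType) (c n : nat) :
  (c%:R : fps R) n = if n == 0%N then c%:R else 0.
Proof. by rewrite -(rmorph_nat (@fpsC R)). Qed.

Section MapFps.
Context (R S : comNzRingType) (phi : {rmorphism R -> S}).

Definition map_fps (f : fps R) : fps S := Fps (fun n => phi (f n)).

Fact map_fps_is_zmod_morphism : zmod_morphism map_fps.
Proof. by move=> f g; apply: fpsP => n /=; rewrite rmorphB. Qed.

Fact map_fps_is_monoid_morphism : monoid_morphism map_fps.
Proof.
split=> [|f g]; apply: fpsP => n /=.
  by case: (n == 0%N); rewrite ?rmorph1 ?rmorph0.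
by rewrite rmorph_sum; apply: eq_bigr => i _; rewrite rmorphM.
Qed.

HB.instance Definition _ :=
  GRing.isZmodMorphism.Build (fps R) (fps S) map_fps map_fps_is_zmod_morphism.
HB.instance Definition _ :=
  GRing.isMonoidMorphism.Build (fps R) (fps S) map_fps map_fps_is_monoid_morphism.

Lemma map_fpsX : map_fps fpsX = fpsX.
Proof. by apply: fpsP => n /=; rewrite rmorph_nat. Qed.

End MapFps.

(** The image is a square root with constant coefficient 1, and there is only one. *)
Lemma map_fps_sqrt (R S : comUnitRingType) (phi : {rmorphism R -> S}) (f : fps R) :
  2 \is a @GRing.unit R -> f 0%N = 1 ->
  map_fps phi (fps_sqrt f) = fps_sqrt (map_fps phi f).
Proof.
move=> U2 f0; apply: fps_sqrt_uniq.
- by rewrite -(rmorph_nat phi) rmorph_unit.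
- exact: rmorph1.
- by rewrite -rmorphXn fps_sqrtK.
Qed.

Lemma fps_nat_unit (R : comUnitRingType) (n : nat) :
  ((n%:R : fps R) \is a GRing.unit) = ((n%:R : R) \is a GRing.unit).
Proof. by rewrite fps_unitE coef_fps_nat. Qed.

Lemma nat_unit_rat n : (n.+1%:R : rat) \is a GRing.unit.
Proof. by rewrite unitfE pnatr_eq0. Qed.

(** * Bicolored Motzkin paths *)

Section Motzkin.
Local Notation x := (fpsX : fps rat).
Local Notation s := (fps_sqrt (1 - 4 * x)).

(* The generating function of bicolored Motzkin paths: [2 / (1 - 2 x + s)] is  *)
(* [(1 - 2 x - s) / (2 x ^ 2)] with the division by [x] cleared.               *)
Definition motzkin2 : fps rat := 2 / (1 - 2 * x + s).

Let U2 : (2 : fps rat) \is a GRing.unit.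
Proof. by rewrite fps_nat_unit nat_unit_rat. Qed.

Lemma coef0_1_4X : (1 - 4 * x) 0%N = 1.
Proof. by rewrite -[LHS]/(1 - (4 * x) 0%N) mulrC coef_fpsXM subr0. Qed.

Lemma sqr_sqrt_1_4X : s ^+ 2 = 1 - 4 * x.
Proof. by rewrite fps_sqrtK ?coef0_1_4X ?nat_unit_rat. Qed.

Let Us : s \is a GRing.unit.
Proof. by rewrite fps_unitE coef0_fps_sqrt unitr1. Qed.

Let Ue : 1 - 2 * x + s \is a GRing.unit.
Proof.
rewrite fps_unitE -[_ 0%N]/(1 - (2 * x) 0%N + s 0%N).
by rewrite mulrC coef_fpsXM subr0 coef0_fps_sqrt; exact: (nat_unit_rat 1).
Qed.

Lemma sqrt_1_4X : s = 1 - 2 * x - 2 * x ^+ 2 * motzkin2.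
Proof.
apply: (mulrI U2); apply: (mulIr Ue).
transitivity (2 * s * (1 - 2 * x) + 2 * s ^+ 2); first by ring.
rewrite sqr_sqrt_1_4X.
transitivity (2 * (1 - 2 * x) * (1 - 2 * x + s)
              - 4 * x ^+ 2 * (motzkin2 * (1 - 2 * x + s))); last by ring.
by rewrite divrK //; ring.
Qed.

(** This is the first-return decomposition [M = 1 + 2 x M + x ^ 2 M ^ 2]. *)
Lemma motzkin2E : motzkin2 * (1 - 2 * x - x ^+ 2 * motzkin2) = 1.
Proof.
apply: (mulrI U2); transitivity (motzkin2 * (1 - 2 * x + s)).
  by rewrite [in RHS]sqrt_1_4X; ring.
by rewrite divrK // mulr1.
Qed.

(** [T] stands for the series of all prefixes: each has four one-step extensions, except that those
    at height 0, counted by [motzkin2], cannot go down. *)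
Lemma half_add_inv_sqrt (T : fps rat) : T = 1 + x * (4 * T - motzkin2) ->
  1 + x * T = 1 / 2 * (1 + 1 / s).
Proof.
move=> T_rec; have Ts : T * s ^+ 2 = 1 - x * motzkin2.
  by rewrite sqr_sqrt_1_4X [in LHS]mulrBr {1}T_rec; ring.
apply: (mulrI U2); apply: (mulIr Us); apply: (mulIr Us).
transitivity (2 * s ^+ 2 + 2 * x * (T * s ^+ 2)); first by ring.
rewrite Ts; transitivity (s ^+ 2 + s * 1).
  rewrite mulr1 sqr_sqrt_1_4X [in RHS]sqrt_1_4X; ring.
transitivity ((2 * (1 / 2)) * (s + s / s) * s); last by ring.
by rewrite !divrr // div1r divrr //; ring.
Qed.

End Motzkin.

(** * Bicolored Motzkin prefixes and the kernel equation *)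

Section Kernel.
Local Notation x := (fpsX : fps (fps rat)).
Local Notation y := (fpsC fpsX : fps (fps rat)).
Local Notation s := (fps_sqrt (1 - 4 * x)).

(** Cutting a prefix at its last passages gives [M / (1 - x y M)], that is
    [1 / (1 - 2 x - x y - x ^ 2 M)], for [M] the series [motzkin2]. *)
Definition motzkin2_prefix : fps (fps rat) := 2 / (1 - 2 * x - 2 * x * y + s).

(* The kernel equation of walks with steps [1 + 2 y + y ^ 2] (weighted by [x], *)
(* all heights shifted by 1) that stay nonnegative; [motzkin2] is [y]-free.    *)
Lemma motzkin2_prefix_kernel :
  y * motzkin2_prefix =
  y + x * ((1 + y) ^+ 2 * motzkin2_prefix - map_fps (@fpsC rat) motzkin2).
Proof.
pose iota : {rmorphism fps rat -> fps (fps rat)} := map_fps (@fpsC rat); set g := map_fps _ _.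
have iotaX : iota fpsX = x by exact: map_fpsX.
have s_g : s = 1 - 2 * x - 2 * x ^+ 2 * g.
  have := congr1 iota sqrt_1_4X; rewrite {1}/iota /= map_fps_sqrt; first last.
  - exact: coef0_1_4X.
  - exact: nat_unit_rat.
  rewrite -[map_fps _ (1 - _)]/(iota (1 - 4 * fpsX)) /g -[map_fps _]/(iota : _ -> _).
  by move: motzkin2 => h; rewrite !(rmorphB, rmorphM, rmorphXn, rmorph_nat, rmorph1) iotaX.
have g1 : g * (1 - 2 * x - x ^+ 2 * g) = 1.
  rewrite /g -[map_fps _]/(iota : _ -> _).
  move: motzkin2 motzkin2E => h /(congr1 iota).
  by rewrite !(rmorphM, rmorphB, rmorph1, rmorphXn, rmorph_nat) iotaX.
have U2 : (2 : fps (fps rat)) \is a GRing.unit.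
  by rewrite !fps_nat_unit nat_unit_rat.
pose e := 1 - 2 * x - x * y - x ^+ 2 * g.
have e2 : 1 - 2 * x - 2 * x * y + s = 2 * e by rewrite s_g /e; ring.
have Ue : e \is a GRing.unit.
  have -> : e = 1 - x * (2 + y + x * g) by rewrite /e; ring.
  rewrite fps_unitE -[_ 0%N]/(1 - (x * _) 0%N).
  by rewrite coef_fpsXM subr0 unitr1.
have Ne : motzkin2_prefix * e = 1.
  apply: (mulrI U2); rewrite mulrCA -e2 divrK ?mulr1 //.
  by rewrite e2 unitrM U2.
apply: (mulIr Ue); apply/eqP; rewrite -subr_eq0; apply/eqP.
set N := motzkin2_prefix in Ne *.
transitivity ((y - x * (1 + y) ^+ 2) * (N * e) - (y - x * g) * e); first by ring.
rewrite Ne mulr1.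
(* All terms in [y] cancel, leaving the quadratic equation of [g]. *)
transitivity (x * (g * (1 - 2 * x - x ^+ 2 * g)) - x); first by rewrite /e; ring.
by rewrite g1; ring.
Qed.

End Kernel.

(** * The Stanley order in terms of down steps *)

Local Open Scope nat_scope.

Local Notation U := true.
Local Notation D := false.

Lemma ordinate_cat s t : ordinate (s ++ t) = (ordinate s + ordinate t)%R.
Proof. by rewrite /ordinate big_cat. Qed.

Lemma ordinate_cons a s : ordinate (a :: s) = ((if a then 1 else -1) + ordinate s)%R.
Proof. by rewrite /ordinate big_cons. Qed.

Lemma ordinateE s : ordinate s = ((size s)%:Z - (count negb s)%:Z *+ 2)%R.
Proof.
elim: s => [|a s IHs]; first by rewrite /ordinate big_nil.
by rewrite ordinate_cons IHs; case: a => /=; lia.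
Qed.

Lemma height_drop s i : height s i = (ordinate s - ordinate (drop i s))%R.
Proof. by rewrite -{2}(cat_take_drop i s) ordinate_cat addrK. Qed.

(** The accumulator [a] is the number of up steps already read. *)
Fixpoint ups_before (a : nat) (s : seq bool) : seq nat :=
  if s is c :: s' then
    if c then ups_before a.+1 s' else a :: ups_before a s'
  else [::].

(* Counting from 0, the [d]-th down step of [s] ends at abscissa               *)
(* [nth 0 (ups_before 0 s) d + d.+1].                                          *)
Lemma ltn_count_take a s i d : d < count negb s ->
  (d < count negb (take i s)) = (nth 0 (ups_before a s) d + d < i + a).
Proof.
elim: s a i d => //= -[] s IHs a i d /=.
  rewrite add0n => ltd; case: i => [|i] /=.
    by have := IHs a.+1 0 d ltd; rewrite take0 /=; lia.
  by rewrite add0n (IHs a.+1) // addnS addSn.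
case: i d => [|i] [|d] //= ltd; first by lia.
- have := IHs a 0 d; rewrite take0 /=; lia.
- lia.
- by rewrite add1n ltnS (IHs a) // addnS addSn ltnS.
Qed.

(** At a given abscissa, the lower path is the one that has made more down steps. *)
Lemma height_leP s t : size s = size t -> count negb s = count negb t ->
  reflect (forall d, d < count negb s ->
             nth 0 (ups_before 0 s) d <= nth 0 (ups_before 0 t) d)
          [forall i : 'I_(size s).+1, (height s i <= height t i)%R].
Proof.
move=> szst ctst.
have heightE i : i <= size s ->
    (height s i <= height t i)%R = (count negb (take i t) <= count negb (take i s)).
  by move=> lei; rewrite /height !ordinateE !size_takel -?szst //; lia.
apply: (iffP forallP) => [le_st d ltd | le_st [i /= lti]].
- have /= ltdt : d < count negb t by rewrite -ctst.
  (* The abscissa where the [d]-th down step of [t] ends; by then [s] must have made as many down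
     steps. *)
  pose i := nth 0 (ups_before 0 t) d + d.+1.
  have dt : d < count negb (take i t).
    by rewrite (ltn_count_take 0) // addn0 /i addnS.
  have [lei | lti] := leqP i (size s).
    have := le_st (Ordinal (lei : i < (size s).+1)); rewrite heightE //= => le_ct.
    have := leq_trans dt le_ct; rewrite (ltn_count_take 0) // /i; lia.
  have : d < count negb (take (size s) s) by rewrite take_size.
  by rewrite (ltn_count_take 0) //; move: lti; rewrite /i; lia.
- rewrite heightE //; case E: (count negb (take i t)) => [|d] //.
  have ltdt : d < count negb t.
    by rewrite -(cat_take_drop i t) count_cat E; lia.
  have : d < count negb (take i t) by rewrite E.
  have ltds : d < count negb s by rewrite ctst.
  rewrite !(ltn_count_take 0) //; have := le_st d ltds; lia.
Qed.

(** * Encoding of paths by words *)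

(* The part of the path that follows the first ascent. *)
Fixpoint tail_path (w : seq bool) : seq bool :=
  if w is c :: w' then D :: (if c then U :: tail_path w' else tail_path w')
  else [:: D].

Definition path_of (w : seq bool) : seq bool :=
  nseq (count negb w).+1 U ++ tail_path w.

Lemma count_tail_path w : count negb (tail_path w) = (size w).+1.
Proof. by elim: w => //= -[] w /= ->. Qed.

Lemma size_tail_path w : size (tail_path w) = (size w + count id w).+1.
Proof. by elim: w => //= -[] w /= ->; lia. Qed.

Lemma count_negbE (w : seq bool) : count negb w = size w - count id w.
Proof. by rewrite -(count_predC id w) addKn. Qed.

Lemma count_path_of w : count negb (path_of w) = (size w).+1.
Proof. by rewrite count_cat count_tail_path count_nseq. Qed.

Lemma size_path_of w : size (path_of w) = (size w).+1.*2.
Proof.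
rewrite size_cat size_nseq size_tail_path.
by have := count_size id w; rewrite count_negbE; lia.
Qed.

Lemma first_ascent_path_of w : first_ascent (path_of w) = (count negb w).+1.
Proof.
rewrite /first_ascent /path_of find_cat has_nseq /= size_nseq.
by case: w => [|c w] /=; rewrite !addn0.
Qed.

(** Every up step of the tail is directly followed by a down step. *)
Lemma ordinate_drop_tail_path w i : (ordinate (drop i (tail_path w)) <= 0)%R.
Proof.
elim: w i => [|c w IHw] [|i] //=; try by rewrite ordinateE /=; lia.
  rewrite ordinateE /=; case: c => /=; rewrite count_tail_path size_tail_path.
    by have := count_size id w; lia.
  by have := count_size id w; lia.
case: c => //; case: i => [|i] //=.
rewrite ordinateE /= count_tail_path size_tail_path.
by have := count_size id w; lia.
Qed.

Lemma is_dyck_path_of w : is_dyck (path_of w).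
Proof.
have ord0 : ordinate (path_of w) = 0%R.
  by rewrite ordinateE size_path_of count_path_of; lia.
rewrite /is_dyck ord0 eqxx; apply/allP => i _; rewrite height_drop ord0 add0r oppr_ge0.
rewrite /path_of drop_cat; case: ifP => [lti | _]; last exact: ordinate_drop_tail_path.
rewrite drop_nseq ordinate_cat !ordinateE size_nseq count_nseq count_tail_path.
rewrite size_tail_path.
by have := count_size id w; rewrite count_negbE; lia.
Qed.

Lemma avoids_cons (alpha : seq bool) a s :
  avoids alpha (a :: s) = ~~ prefix alpha (a :: s) && avoids alpha s.
Proof. by rewrite /avoids infix_consl negb_or. Qed.

Lemma avoids_path_of w : avoids [:: D; U; U] (path_of w).
Proof.
have avt : avoids [:: D; U; U] (tail_path w).
  elim: w => //= c w IHw; rewrite avoids_cons.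
  by case: c; rewrite /= ?avoids_cons IHw; case: (w) => //= -[].
by rewrite /path_of; elim: _.+1 => //= n IHn; rewrite avoids_cons.
Qed.

(** After a down step, an up step must be followed by a down step: a second up step would create
    [DUU], and the word does not end with [U]. *)
Lemma avoids_tail_path s : last D s = D -> avoids [:: D; U; U] (D :: s) ->
  exists w, D :: s = tail_path w.
Proof.
have [n] := ubnP (size s); elim: n s => // n IHn [|c s] /= ltn lasts avs.
  by exists [::].
case: c lasts avs => [|lasts]; last first.
  rewrite avoids_cons => /andP[_ avs].
  by have [w ->] := IHn s ltn lasts avs; exists (false :: w).
case: s ltn => [|[] s] //= ltn lasts; first by rewrite avoids_cons /= prefix0s.
rewrite 2!avoids_cons => /and3P[_ _ avs].
by have [|w ->] := IHn s _ lasts avs; [exact: ltnW | exists (true :: w)].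
Qed.

Lemma dyck_avoidsE n (s : seq bool) : size s = n.+1.*2 -> is_dyck s ->
  avoids [:: D; U; U] s -> exists2 w, size w = n & s = path_of w.
Proof.
move=> szs /andP[/eqP ords /allP hts] avs.
have cts : count negb s = n.+1 by move: ords; rewrite ordinateE szs; lia.
have lasts : last U s = D.
  (* Before a final up step the path would be at height -1. *)
  apply/negP => lastU.
  case/lastP: s szs ords hts lastU {avs cts} => // s c; rewrite last_rcons.
  rewrite size_rcons -cats1 ordinate_cat => szs ords hts c_.
  have := hts (size s); rewrite mem_iota add0n ltnS leqnSn => /(_ isT).
  rewrite /height take_size_cat //; move: ords; rewrite c_ ordinate_cons ordinateE /=.
  by rewrite /ordinate big_nil; lia.
have [a [t s_at]] : exists a t, s = nseq a U ++ D :: t.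
  have: has negb s by rewrite has_count cts.
  elim: s {szs ords hts avs cts lasts} => //= -[] s IHs /=.
    by case/IHs => a [t ->]; exists a.+1, t.
  by move=> _; exists 0, s.
have [w tw] : exists w, D :: t = tail_path w.
  apply: avoids_tail_path; first by move: lasts; rewrite s_at last_cat.
  by move: avs; apply: contraNN => inf; rewrite s_at; apply: infix_catl.
rewrite tw in s_at.
have szw : size w = n.
  by move: cts; rewrite s_at count_cat count_nseq count_tail_path /=; lia.
(* The total length forces the value of [a]. *)
exists w => //; rewrite s_at /path_of; congr (nseq _ _ ++ _).
move: szs; rewrite s_at size_cat size_nseq size_tail_path count_negbE szw.
by have := count_size id w; lia.
Qed.

(** Since [tail_path] always starts with [D], the step after this [D] reveals the first letter. *)
Lemma tail_path_inj : injective tail_path.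
Proof.
have tailE w : exists t, tail_path w = D :: t.
  by case: w => [|c w]; [exists [::] | eexists].
elim=> [|c p IHp] [|d q] //= [].
- by have [t ->] := tailE q; case: d.
- by have [t ->] := tailE p; case: c.
- have [[t Ep] [u Eq]] := (tailE p, tailE q).
  case: c d => [] [] E; first by case: E => /IHp ->.
  + by rewrite Eq in E.
  + by rewrite Ep in E.
  + by rewrite (IHp _ E).
Qed.

Lemma path_of_inj : injective path_of.
Proof.
move=> p q pq; have := congr1 first_ascent pq; rewrite !first_ascent_path_of.
move=> [eqn]; move/eqP: pq; rewrite /path_of eqn eqseq_cat //.
by case/andP => _ /eqP /tail_path_inj.
Qed.

Lemma nth_ups_before_nseq a b s d :
  nth 0 (ups_before a (nseq b U ++ s)) d = nth 0 (ups_before (a + b) s) d.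
Proof. by elim: b a => [|b IHb] a /=; rewrite ?addn0 // IHb addnS. Qed.

Lemma nth_ups_before_tail a w d : d <= size w ->
  nth 0 (ups_before a (tail_path w)) d = a + count id (take d w).
Proof.
elim: w a d => [|c w IHw] a [|d] //=; rewrite ?addn0 // ltnS => led.
by case: c => /=; rewrite IHw //; lia.
Qed.

(** * Dominance of words *)

Fixpoint dominates (p q : seq bool) : bool :=
  if p is c :: p' then
    if q is d :: q' then
      (count id (d :: q') <= count id (c :: p')) && dominates p' q'
    else true
  else true.

Lemma dominatesP p q : size p = size q ->
  reflect (forall d, d <= size p -> count id (drop d q) <= count id (drop d p))
          (dominates p q).
Proof.
elim: p q => [|c p IHp] [|d q] //=; first by left.
case=> /IHp {}IHp; apply: (iffP andP) => [[le_qp /IHp dom] [|i] //|le_qp].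
  exact: dom.
by split; [exact: (le_qp 0) | apply/IHp => i; exact: (le_qp i.+1)].
Qed.

(** In [path_of w], the [d]-th down step is preceded by [n.+1 - count id (drop d w)] up steps; the
    subtraction reverses the comparison. *)
Lemma height_path_of_le n p q : size p = n -> size q = n ->
  [forall i : 'I_n.+1.*2.+1,
     (height (path_of p) i <= height (path_of q) i)%R] = dominates p q.
Proof.
move=> <- /esym szpq; rewrite -size_path_of; apply/height_leP/dominatesP => //.
- by rewrite !size_path_of szpq.
- by rewrite !count_path_of szpq.
- move=> le_pq d led; have := le_pq d; rewrite count_path_of => /(_ led).
  rewrite /path_of !nth_ups_before_nseq !nth_ups_before_tail -?szpq //.
  rewrite !count_negbE -szpq.
  have := cat_take_drop d p; have := cat_take_drop d q.
  move=> /(congr1 (count id)) + /(congr1 (count id)); rewrite !count_cat.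
  by have := count_size id p; have := count_size id q; lia.
- move=> dom d; rewrite count_path_of ltnS => led; have := dom d led.
  rewrite /path_of !nth_ups_before_nseq !nth_ups_before_tail -?szpq //.
  rewrite !count_negbE -szpq.
  have := cat_take_drop d p; have := cat_take_drop d q.
  move=> /(congr1 (count id)) + /(congr1 (count id)); rewrite !count_cat.
  by have := count_size id p; have := count_size id q; lia.
Qed.

Lemma dominates_count p q : size p = size q -> dominates p q ->
  count id q <= count id p.
Proof. by move=> szpq /(dominatesP szpq) /(_ 0); rewrite !drop0; apply. Qed.

Section DyckDUUOf.
Context (n : nat).

Fact size_path_of_tuple (w : n.-tuple bool) : size (path_of w) == n.+1.*2.
Proof. by rewrite size_path_of size_tuple. Qed.

Fact path_of_tupleP (w : n.-tuple bool) :
  is_dyck (Tuple (size_path_of_tuple w))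
    && avoids [:: D; U; U] (Tuple (size_path_of_tuple w)).
Proof. by rewrite is_dyck_path_of avoids_path_of. Qed.

Definition dyckDUU_of (w : n.-tuple bool) : dyckDUU n.+1 :=
  DyckDUU (path_of_tupleP w).

Lemma dyckDUU_of_inj : injective dyckDUU_of.
Proof.
move=> p q pq; apply/val_inj/path_of_inj.
exact: (congr1 (fun P : dyckDUU n.+1 => tval (word P)) pq).
Qed.

Lemma dyckDUU_of_surj (P : dyckDUU n.+1) : exists w, P = dyckDUU_of w.
Proof.
case: P => s Ps; have /andP[dyck_s av_s] := Ps.
have [w szw s_w] := dyck_avoidsE (size_tuple s) dyck_s av_s.
have /eqP szw' := szw; exists (Tuple szw').
by apply/val_inj/val_inj; rewrite /= s_w.
Qed.

Lemma dyckDUU_of_le p q : (dyckDUU_of p <= dyckDUU_of q)%O = dominates p q.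
Proof. by apply: height_path_of_le; rewrite size_tuple. Qed.

End DyckDUUOf.

(** * Counting dominating pairs *)

(** Asking for a difference at least [k], not equal to [k], makes the count a single binomial
    coefficient. *)
Definition num_dom n k : nat :=
  #|[set pq : n.-tuple bool * n.-tuple bool |
      dominates pq.1 pq.2 && (count id pq.2 + k <= count id pq.1)]|.

Lemma num_domE n k : num_dom n k =
  \sum_(p : n.-tuple bool) \sum_(q : n.-tuple bool)
    (dominates p q && (count id q + k <= count id p)).
Proof.
rewrite /num_dom -sum1_card pair_big big_mkcond /=.
by apply: eq_bigr => pq _; rewrite inE; case: (_ && _).
Qed.

Lemma sum_tuple_cons (T : finType) n (F : n.+1.-tuple T -> nat) :
  \sum_p F p = \sum_(c : T) \sum_(p : n.-tuple T) F [tuple of c :: p].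
Proof.
rewrite pair_big (reindex (fun cp : T * n.-tuple T => [tuple of cp.1 :: cp.2])) //.
exists (fun t : n.+1.-tuple T => (thead t, [tuple of behead t])) => [[c p] _ | t _].
  by congr pair; apply: val_inj.
by rewrite [in RHS](tuple_eta t).
Qed.

(* For [k = 0] the truncation in [k.-1] is intended: dominance already forces  *)
(* [count id q <= count id p].                                                 *)
Lemma num_domS n k :
  num_dom n.+1 k = num_dom n k * 2 + num_dom n k.-1 + num_dom n k.+1.
Proof.
(* Split by first letters: equal letters keep the difference, [U] over [D] raises it and [D] over
   [U] lowers it. *)
have sumE (F : bool -> n.-tuple bool -> bool -> n.-tuple bool -> nat) :
    \sum_c \sum_p \sum_d \sum_q F c p d q =
    \sum_p \sum_q F U p U q + \sum_p \sum_q F D p D q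
    + \sum_p \sum_q F U p D q + \sum_p \sum_q F D p U q.
  have splitE c : \sum_p \sum_d \sum_q F c p d q =
      \sum_p \sum_q F c p U q + \sum_p \sum_q F c p D q.
    by rewrite -big_split; apply: eq_bigr => p _; rewrite big_bool.
  by rewrite big_bool /= !splitE -!addnA; congr (_ + _); rewrite addnA addnC.
rewrite num_domE sum_tuple_cons.
under eq_bigr => c _ do under eq_bigr => p _ do rewrite sum_tuple_cons.
rewrite sumE muln2 -addnn !num_domE.
have dom_le (p q : n.-tuple bool) : dominates p q -> count id q <= count id p.
  by apply: dominates_count; rewrite !size_tuple.
congr (_ + _ + _ + _); apply: eq_bigr => p _; apply: eq_bigr => q _ /=;
  case: (boolP (dominates p q)) => [/dom_le|]; rewrite ?andbF //; lia.
Qed.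

Lemma num_dom_bin n k : num_dom n k = 'C(n.*2.+1, n.+1 + k).
Proof.
elim: n k => [|n IHn] k.
  have pred1_nil (p : 0.-tuple bool) : true = pred1 [tuple] p.
    by apply/esym/eqP; exact: tuple0.
  by rewrite num_domE !(big_pred1 [tuple]) //; case: k.
have pascal2 m j : 'C(m.+2, j.+2) = 'C(m, j.+1) * 2 + 'C(m, j) + 'C(m, j.+2).
  by rewrite !binS; lia.
rewrite num_domS !IHn doubleS !addSn pascal2 addnS; case: k => [|k] /=.
  (* For [k = 0], [k.-1] is still 0, and symmetry of binomials supplies the term that Pascal's rule
     asks for. *)
  rewrite addn0; have -> // : 'C(n.*2.+1, n) = 'C(n.*2.+1, n.+1).
  by rewrite -bin_sub; [congr 'C(_, _); lia | lia].
by rewrite addnS.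
Qed.

(** * From intervals to ordered pairs *)

Definition ordered_pairs n : {set dyckDUU n * dyckDUU n} :=
  [set PQ | (PQ.1 <= PQ.2)%O].

Definition ordered_pairs_ascent n (k : nat) : {set dyckDUU n * dyckDUU n} :=
  [set PQ in ordered_pairs n |
    ((first_ascent PQ.2)%:Z - (first_ascent PQ.1)%:Z == k%:Z)%R].

(** The endpoints are the least and greatest elements of the interval. *)
Lemma interval_set_inj n :
  {in ordered_pairs n &, injective (fun PQ => interval_set PQ.1 PQ.2)}.
Proof.
move=> [P Q] [P' Q']; rewrite !inE /= => lePQ lePQ' /setP eqI.
have memI R : (P <= R <= Q)%O = (P' <= R <= Q')%O by have := eqI R; rewrite !inE.
have /andP[leP'P _] : (P' <= P <= Q')%O by rewrite -memI lexx.
have /andP[_ leQQ'] : (P' <= Q <= Q')%O by rewrite -memI lexx lePQ.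
have /andP[lePP' _] : (P <= P' <= Q)%O by rewrite memI lexx.
have /andP[_ leQ'Q] : (P <= Q' <= Q)%O by rewrite memI lexx lePQ'.
by congr pair; apply: le_anti; apply/andP.
Qed.

Lemma card_intervals n : #|intervals n| = #|ordered_pairs n|.
Proof.
rewrite -(card_in_imset (@interval_set_inj n)); congr #|pred_of_set _|.
apply/setP => I; rewrite inE; apply/existsP/imsetP => [[P /existsP[Q]]|[[P Q]]].
  by case/andP=> lePQ /eqP ->; exists (P, Q); rewrite ?inE.
by rewrite inE /= => lePQ ->; exists P; apply/existsP; exists Q; rewrite lePQ /=.
Qed.

Lemma card_intervals_ascent n k :
  #|intervals_ascent n k| = #|ordered_pairs_ascent n k|.
Proof.
have inj : {in ordered_pairs_ascent n k &,
    injective (fun PQ => interval_set PQ.1 PQ.2)}.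
  by apply: sub_in2 (@interval_set_inj n) => PQ; rewrite inE => /andP[].
rewrite -(card_in_imset inj); congr #|pred_of_set _|.
apply/setP => I; rewrite inE; apply/existsP/imsetP => [[P /existsP[Q]]|[[P Q]]].
  by case/and3P=> lePQ /eqP -> asc; exists (P, Q); rewrite ?inE ?lePQ.
rewrite !inE /= => /andP[lePQ asc] ->.
by exists P; apply/existsP; exists Q; rewrite lePQ asc eqxx.
Qed.

Lemma dyckDUU0_eq (P Q : dyckDUU 0) : P = Q.
Proof. by apply: val_inj; rewrite [RHS]tuple0 [LHS]tuple0. Qed.

Fact dyckDUU0_subproof : is_dyck [tuple] && avoids [:: D; U; U] [tuple].
Proof. by rewrite /is_dyck /height /ordinate /= !big_nil. Qed.

Lemma card_ordered_pairs0 : #|ordered_pairs 0| = 1.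
Proof.
pose P0 : dyckDUU 0 := @DyckDUU 0 [tuple] dyckDUU0_subproof.
rewrite -(cards1 (P0, P0)); congr #|pred_of_set _|; apply/setP => -[P Q].
by rewrite !inE /= (dyckDUU0_eq P P0) (dyckDUU0_eq Q P0) lexx eqxx.
Qed.

Lemma card_ordered_pairs_ascent0 k : #|ordered_pairs_ascent 0 k| = (k == 0).
Proof.
case: k => [|k]; last first.
  apply: eq_card0 => -[P Q]; rewrite !inE /= (dyckDUU0_eq P Q) subrr.
  by rewrite andbF.
rewrite eqxx -[RHS]card_ordered_pairs0; apply: eq_card => -[P Q].
by rewrite !inE /= (dyckDUU0_eq P Q) subrr eqxx andbT.
Qed.

Definition dyckDUU_pair n (pq : n.-tuple bool * n.-tuple bool) :=
  (dyckDUU_of pq.1, dyckDUU_of pq.2).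

Lemma dyckDUU_pair_inj n : injective (@dyckDUU_pair n).
Proof.
move=> [p q] [p' q'] /eqP; rewrite xpair_eqE => /andP[].
by move=> /eqP/dyckDUU_of_inj /= -> /eqP/dyckDUU_of_inj /= ->.
Qed.

Lemma card_ordered_pairsS n : #|ordered_pairs n.+1| = num_dom n 0.
Proof.
rewrite /num_dom -(card_imset _ (@dyckDUU_pair_inj n)); apply: eq_card => -[P Q].
have [[p ->] [q ->]] := (dyckDUU_of_surj P, dyckDUU_of_surj Q).
rewrite inE /= dyckDUU_of_le (mem_imset _ (p, q) (@dyckDUU_pair_inj n)) inE /= addn0.
by case: (boolP (dominates p q)) => // /dominates_count ->; rewrite ?size_tuple.
Qed.

(** A difference at least [k] is either exactly [k] or at least [k.+1]. *)
Lemma card_ordered_pairs_ascentS n k :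
  (#|ordered_pairs_ascent n.+1 k| + num_dom n k.+1)%N = num_dom n k.
Proof.
pose B := [set pq : n.-tuple bool * n.-tuple bool |
            count id pq.2 + k.+1 <= count id pq.1].
rewrite {2}/num_dom -(cardsID B) addnC; congr (_ + _).
  apply: eq_card => -[p q]; rewrite !inE /= -andbA.
  by case: (dominates p q) => //=; apply/idP/andP => [|[]//]; lia.
rewrite -(card_imset _ (@dyckDUU_pair_inj n)); apply: eq_card => -[P Q].
have [[p ->] [q ->]] := (dyckDUU_of_surj P, dyckDUU_of_surj Q).
rewrite !inE /= dyckDUU_of_le (mem_imset _ (p, q) (@dyckDUU_pair_inj n)).
rewrite !inE /=.
have /= -> := first_ascent_path_of p; have /= -> := first_ascent_path_of q.
rewrite !count_negbE !size_tuple.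
case: (dominates p q); rewrite ?andbF //=.
have := count_size id p; have := count_size id q; rewrite !size_tuple.
by lia.
Qed.

Local Open Scope ring_scope.

(** * Coefficients of the kernel equation *)

Section Coefficients.
Local Notation N := motzkin2_prefix.

Lemma coef_motzkin2_prefix_kernel n k :
  (fpsX * N n) k = (if n is m.+1 then
    N m k + 2 * (fpsX * N m) k + (fpsX * (fpsX * N m)) k - fpsC (motzkin2 m) k
    else (fpsX : fps rat) k) .
Proof.
have /(congr1 (fun f : fps (fps rat) => f n k)) := motzkin2_prefix_kernel.
rewrite coef_fpsCM => ->.
rewrite -[LHS]/((fpsC fpsX : fps (fps rat)) n k + (fpsX * _ : fps (fps rat)) n k).
rewrite coef_fpsXM; case: n => [|n]; first by rewrite addr0.
rewrite add0r.
have -> : (1 + fpsC fpsX) ^+ 2 * N =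
    N + (fpsC fpsX * N + fpsC fpsX * N) + fpsC fpsX * (fpsC fpsX * N) by ring.
rewrite -[LHS]/(N n k + ((fpsC fpsX * N) n k + (fpsC fpsX * N) n k)
  + (fpsC fpsX * (fpsC fpsX * N)) n k - fpsC (motzkin2 n) k).
by rewrite !coef_fpsCM; ring.
Qed.

(** The coefficient of [y ^ k.+1] in the kernel equation is the recurrence for pairs of difference
    exactly [k]; there the [y]-free term vanishes. *)
Lemma coef_motzkin2_prefix n k :
  N n k = (num_dom n k)%:R - (num_dom n k.+1)%:R.
Proof.
elim: n k => [|n IHn] k.
  have := coef_motzkin2_prefix_kernel 0 k.+1; rewrite coef_fpsXM => ->.
  by rewrite !num_dom_bin; case: k.
have := coef_motzkin2_prefix_kernel n.+1 k.+1; rewrite !coef_fpsXM /= => ->.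
rewrite !num_domS !natrD !natrM; case: k => [|k] /=; rewrite !IHn; ring.
Qed.

(** The left side of the kernel equation has no term in [y ^ 0], which forces [motzkin2] to count
    the prefixes ending at height 0. *)
Lemma coef_motzkin2 n : motzkin2 n = (num_dom n 0)%:R - (num_dom n 1)%:R.
Proof.
have := coef_motzkin2_prefix_kernel n.+1 0; rewrite !coef_fpsXM /= => /eqP.
by rewrite mulr0 !addr0 eq_sym subr_eq0 => /eqP <-; rewrite coef_motzkin2_prefix.
Qed.

End Coefficients.

Theorem theorem4p5 :
  [/\ let x : fps (fps rat) := fpsX in
      let y : fps (fps rat) := fpsC fpsX in
      Fps (fun n : nat => Fps (fun k : nat => #|intervals_ascent n k|%:R : rat))
        = 1 + 2 * x / (1 - 2 * x - 2 * x * y + fps_sqrt (1 - 4 * x)),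
      let x : fps rat := fpsX in
      Fps (fun n : nat => #|intervals n|%:R : rat)
        = 1 / 2 * (1 + 1 / fps_sqrt (1 - 4 * x)) &
      forall n : nat, (1 <= n)%N -> #|intervals n| = 'C((2 * n - 1)%N, n)].
Proof.
split.
(* The right side is [1 + x * motzkin2_prefix]: words are one shorter than the semilength, and 1
   counts the empty path. *)
- move=> x y; rewrite [2 * x]mulrC -mulrA -/motzkin2_prefix.
  rewrite [x * 2]mulrC -/motzkin2_prefix.
  apply: fpsP => n; apply: fpsP => k.
  rewrite -[RHS]/((1 : fps (fps rat)) n k + (x * motzkin2_prefix) n k).
  rewrite coef_fpsXM /= card_intervals_ascent; case: n => [|n].
    by rewrite card_ordered_pairs_ascent0 addr0; case: k.
  by rewrite add0r coef_motzkin2_prefix -(card_ordered_pairs_ascentS n k) natrD addrK.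
- move=> x; rewrite -(half_add_inv_sqrt (T := Fps (fun n => (num_dom n 0)%:R))).
    apply: fpsP => n; rewrite -[RHS]/((1 : fps rat) n + (x * _) n) coef_fpsXM /=.
    rewrite card_intervals; case: n => [|n]; first by rewrite card_ordered_pairs0 addr0.
    by rewrite card_ordered_pairsS add0r.
  set T := Fps _; apply: fpsP => n.
  rewrite -[RHS]/((1 : fps rat) n + (x * _) n) coef_fpsXM; case: n => [|n].
    by rewrite /= num_dom_bin addr0.
  have -> : 4 * T - motzkin2 = T + T + T + T - motzkin2 by ring.
  rewrite add0r -[RHS]/(T n + T n + T n + T n - motzkin2 n) coef_motzkin2 /=.
  (* At [k = 0] the recurrence gives [3 * num_dom n 0 + num_dom n 1], which is [4 * num_dom n 0]
     less the coefficient of [motzkin2]. *)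
  rewrite num_domS /= !natrD natrM; ring.
- case=> // n _; rewrite card_intervals card_ordered_pairsS num_dom_bin addn0.
  by congr 'C(_, _); lia.
Qed.
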